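(* Let $a<b$ be real numbers and let $f \in C^1[a,b]$ be a real-valued function that is monotone on $[a,b]$. Then, for all $\alpha \in (0,1)$, the Caputo derivative $D^\alpha_{*a} f$ does not have a change of sign in $[a,b]$.
   Context: For $f \in C^1[a,b]$ and $\alpha \in (0,1)$, the Caputo derivative of order $\alpha$ of $f$ with starting point $a$ is $D^\alpha_{*a} f(t) := J^{1-\alpha}_a f'(t)$, where for $\beta>0$ the Riemann-Liouville integral operator with starting point $a$ is $J^\beta_a g(t) := \frac{1}{\Gamma(\beta)} \int_a^t (t-s)^{\beta-1} g(s)\,\mathrm{d}s$. Thus $D^\alpha_{*a} f(t) = \frac{1}{\Gamma(1-\alpha)} \int_a^t (t-s)^{-\alpha} f'(s)\,\mathrm{d}s$ for $t \in [a,b]$ (in particular, the value at $t=a$ is $0$). ''Monotone'' means increasing or decreasing, in the non-strict sense. A function $h$ does not have a change of sign in $[a,b]$ if either $h(t) \ge 0$ for all $t \in [a,b]$ or $h(t) \le 0$ for all $t \in [a,b]$. *)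

(* Defs.v *)
From HB Require Import structures.
From mathcomp Require Import all_boot all_order all_algebra.
From mathcomp Require Import all_classical all_reals all_analysis.
Set Implicit Arguments.
Unset Strict Implicit.
Unset Printing Implicit Defensive.
Import Order.TTheory GRing.Theory Num.Theory.
Import numFieldNormedType.Exports.
Local Open Scope classical_set_scope.
Local Open Scope ring_scope.

(* A function on [a, b] is represented by a total f : R -> R; the notions below
   only look at the values of f on [a, b].  Derivatives are therefore taken
   relative to [a, b], i.e., they are one-sided at a and at b. *)
Definition slope_in (R : realType) (a b : R) (f : R -> R) (x : R) :=
  (f y - f x) / (y - x) @[y --> within `[a, b] x^'].

Definition derivable_in (R : realType) (a b : R) (f : R -> R) (x : R) : Prop :=
  cvg (slope_in a b f x).

Definition deriv_in (R : realType) (a b : R) (f : R -> R) (x : R) : R :=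
  lim (slope_in a b f x).

Definition C1 (R : realType) (a b : R) (f : R -> R) : Prop :=
  (forall x, x \in `[a, b] -> derivable_in a b f x) /\
  {within `[a, b], continuous (deriv_in a b f)}.

Definition Gamma (R : realType) (beta : R) : R :=
  \int[lebesgue_measure]_(x in `]0, +oo[) (x `^ (beta - 1) * expR (- x)).

(* As 0 `^ p = 0 for p != 0, the integrand takes the value 0 at the singularity
   s = t when beta < 1; this does not affect the Lebesgue integral. *)
Definition RL_integral (R : realType) (beta a : R) (g : R -> R) (t : R) : R :=
  (Gamma beta)^-1 *
  \int[lebesgue_measure]_(s in `[a, t]) ((t - s) `^ (beta - 1) * g s).

(* The argument b only records the domain [a, b] of f. *)
Definition caputo (R : realType) (alpha a b : R) (f : R -> R) (t : R) : R :=
  RL_integral (1 - alpha) a (deriv_in a b f) t.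

Definition monotone_on (R : realType) (a b : R) (f : R -> R) : Prop :=
  {in `[a, b] &, {homo f : x y / x <= y}} \/
  {in `[a, b] &, {homo f : x y /~ x <= y}}.

Definition no_sign_change (R : realType) (a b : R) (h : R -> R) : Prop :=
  (forall t, t \in `[a, b] -> 0 <= h t) \/
  (forall t, t \in `[a, b] -> h t <= 0).

(* Main.v *)
Require Import Defs.
From HB Require Import structures.
From mathcomp Require Import all_boot all_order all_algebra.
From mathcomp Require Import all_classical all_reals all_analysis.
Set Implicit Arguments.
Unset Strict Implicit.
Unset Printing Implicit Defensive.
Import Order.TTheory GRing.Theory Num.Theory.
Import numFieldNormedType.Exports.
Local Open Scope classical_set_scope.
Local Open Scope ring_scope.

(** The difference quotients of a monotone function all have the same sign,
    so the derivative, being their limit, keeps this weak sign on the whole of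
    [a, b] ([deriv_in_ge0], [deriv_in_le0]).  The Caputo derivative at t is the
    integral over [a, t] of this derivative against the kernel
    (t - s)^(-alpha) / Gamma(1 - alpha), which is nonnegative, hence it
    inherits the sign ([RL_integral_ge0], [RL_integral_le0]).

    Two points need care.  A limit along a filter preserves weak inequalities
    only if the filter is proper, that is, if no point of the nondegenerate
    interval is isolated in it ([within_itv_dnbhs_proper]).  And a real-valued
    integral is the finite part of an extended-real one, an infinite value
    being sent to 0, which is compatible with either weak sign. *)

(** At the right endpoint the punctured neighbourhoods have to be met from the
    left, and everywhere else they can be met from the right. *)
Lemma within_itv_dnbhs_proper (R : realType) (a b x : R) :
  a < b -> x \in `[a, b] -> ProperFilter (within `[a, b] x^').
Proof.
move=> ab; rewrite in_itv /= => /andP[ax xb].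
apply: Build_ProperFilter => -[e /= e0 xe].
have e2 : 0 < e / 2 by rewrite divr_gt0.
have e2e : e / 2 < e by rewrite gtr_pMr // invf_lt1 ?ltr1n.
have [xltb|] := ltP x b.
  pose y := Num.min b (x + e / 2).
  have xy : x < y by rewrite lt_min xltb ltrDl.
  apply: (xe y) => /=.
  - rewrite ltr0_norm ?subr_lt0// opprB ltrBlDl.
    by apply: le_lt_trans (_ : x + e / 2 < _); rewrite ?ge_min ?lexx ?orbT ?ltrD2l.
  - by rewrite gt_eqF.
  - by rewrite in_itv /= (le_trans ax (ltW xy)) ge_min lexx.
move=> bx; have {bx xb} xE : x = b by apply/eqP; rewrite eq_le xb.
pose y := Num.max a (x - e / 2).
have yx : y < x by rewrite gt_max {1}xE ab ltrBlDr ltrDl.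
apply: (xe y) => /=.
- rewrite gtr0_norm ?subr_gt0// ltrBlDl -ltrBlDr.
  by apply: lt_le_trans (_ : _ < x - e / 2) _; rewrite ?le_max ?lexx ?orbT ?ltrD2l ?ltrN2.
- by rewrite lt_eqF.
- by rewrite in_itv /= le_max lexx -xE (ltW yx).
Qed.

Lemma deriv_in_ge0 (R : realType) (a b x : R) (f : R -> R) :
    a < b -> {in `[a, b] &, {homo f : y z / y <= z}} ->
    x \in `[a, b] -> derivable_in a b f x ->
  0 <= deriv_in a b f x.
Proof.
move=> ab fi xab df; have FF := within_itv_dnbhs_proper ab xab.
apply: limr_ge => //; near=> y.
have yab : y \in `[a, b] by near: y; apply: withinT.
have [yx|xy] := leP y x.
  (* Both differences are nonpositive: change the sign of each. *)
  by rewrite -mulrNN -invrN !opprB mulr_ge0 ?invr_ge0 ?subr_ge0 ?fi.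
by rewrite mulr_ge0 ?invr_ge0 ?subr_ge0 ?fi // ltW.
Unshelve. all: by end_near. Qed.

Lemma deriv_in_le0 (R : realType) (a b x : R) (f : R -> R) :
    a < b -> {in `[a, b] &, {homo f : y z /~ y <= z}} ->
    x \in `[a, b] -> derivable_in a b f x ->
  deriv_in a b f x <= 0.
Proof.
move=> ab fd xab df; have FF := within_itv_dnbhs_proper ab xab.
apply: limr_le => //; near=> y.
have yab : y \in `[a, b] by near: y; apply: withinT.
have [yx|xy] := leP y x.
  by rewrite mulr_ge0_le0 ?invr_le0 ?subr_ge0 ?subr_le0 ?fd.
by rewrite mulr_le0_ge0 ?invr_ge0 ?subr_ge0 ?subr_le0 ?fd // ltW.
Unshelve. all: by end_near. Qed.

(** Rewriting [f] as the opposite of a nonnegative function lets the minus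
    sign be pulled out of the extended-real integral even when the latter is
    infinite. *)
Lemma Rintegral_le0 d (T : measurableType d) (R : realType)
    (mu : {measure set T -> \bar R}) (D : set T) (f : T -> R) :
  (forall x, D x -> f x <= 0) -> \int[mu]_(x in D) f x <= 0.
Proof.
move=> f0; apply: fine_le0.
under eq_integral do rewrite -[f _]opprK EFinN.
rewrite integral_ge0N => [|x Dx]; last by rewrite lee_fin oppr_ge0 f0.
by rewrite oppe_le0 integral_ge0 // => x Dx; rewrite lee_fin oppr_ge0 f0.
Qed.

Lemma Gamma_ge0 (R : realType) (beta : R) : 0 <= Gamma beta.
Proof.
by apply: Rintegral_ge0 => x _; rewrite mulr_ge0 ?powR_ge0 ?expR_ge0.
Qed.

Lemma RL_integral_ge0 (R : realType) (beta a t : R) (g : R -> R) :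
  (forall s, s \in `[a, t] -> 0 <= g s) -> 0 <= RL_integral beta a g t.
Proof.
move=> g0; rewrite mulr_ge0 ?invr_ge0 ?Gamma_ge0 //.
by apply: Rintegral_ge0 => s sat; rewrite mulr_ge0 ?powR_ge0 ?g0.
Qed.

Lemma RL_integral_le0 (R : realType) (beta a t : R) (g : R -> R) :
  (forall s, s \in `[a, t] -> g s <= 0) -> RL_integral beta a g t <= 0.
Proof.
move=> g0; rewrite mulr_ge0_le0 ?invr_ge0 ?Gamma_ge0 //.
by apply: Rintegral_le0 => s sat; rewrite mulr_ge0_le0 ?powR_ge0 ?g0.
Qed.

Theorem corollary2p1 (R : realType) (a b : R) (hab : a < b) (f : R -> R)
    (hC1 : C1 a b f) (hmono : monotone_on a b f) :
  forall alpha : R, 0 < alpha < 1 -> no_sign_change a b (caputo alpha a b f).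
Proof.
move=> alpha _; case: hC1 => df _.
have sub t s : t \in `[a, b] -> s \in `[a, t] -> s \in `[a, b].
  rewrite !in_itv /= => /andP[_ tb] /andP[-> st].
  exact: le_trans st tb.
case: hmono => fmono; [left | right] => t tab.
  apply: RL_integral_ge0 => s /(sub _ _ tab) sab.
  exact: deriv_in_ge0 (df _ sab).
apply: RL_integral_le0 => s /(sub _ _ tab) sab.
exact: deriv_in_le0 (df _ sab).
Qed.
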